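(* Let $S$ be a finite set of positive integers that is $n$-admissible for some $n$. If $S=\emptyset$ let $m=1$; otherwise let $m=\max(S)$. Fix an integer $k\ge 2$. Then there is a polynomial $p_{\alpha(k)}$ in one variable, of degree $m-1$ and taking integer values at all integers, such that \[ |P(S;n)^{\nearrow k}| = p_{\alpha(k)}(n) \] for every integer $n\ge k$ such that $S\subset[n-1]$ and $S$ is $n$-admissible.
   Context: Notation: $[n]=\{1,\dots,n\}$. $\mathfrak{S}_n$ is the symmetric group on $[n]$, with permutations written in one-line notation $\pi=\pi_1\pi_2\cdots\pi_n$. An index $i$ with $2\le i\le n-1$ is a peak of $\pi$ if $\pi_{i-1}<\pi_i>\pi_{i+1}$; $P(\pi)$ is the set of peaks of $\pi$, and $P(S;n)=\{\pi\in\mathfrak{S}_n\mid P(\pi)=S\}$. A set $S\subset[n]$ is $n$-admissible if $P(S;n)\ne\emptyset$. For $1\le k\le n$, $P(S;n)^{\nearrow k}=\{\pi\in P(S;n)\mid \pi_{n-1}<\pi_n\text{ and }\pi_n=k\}$. *)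

(* Defs.v *)
From HB Require Import structures.
From mathcomp Require Import all_boot all_order all_fingroup all_algebra.
From mathcomp Require Import finmap.

Set Implicit Arguments.
Unset Strict Implicit.
Unset Printing Implicit Defensive.

Local Open Scope nat_scope.
Local Open Scope fset_scope.

(* [n] = {1, ..., n}. *)
Definition range1 (n : nat) : {fset nat} := [fset i in iota 1 n].

(* 'S_n permutes {0, ..., n-1}; shifting the values by one gives the one-line
   notation pi_1 ... pi_n of a permutation of [n]. *)
Definition one_line (n : nat) (pi : 'S_n) : seq nat :=
  [seq (pi j).+1 | j <- enum 'I_n].

(* The letter pi_i; meaningful for 1 <= i <= n only. *)
Definition letter (n : nat) (pi : 'S_n) (i : nat) : nat :=
  nth 0 (one_line pi) i.-1.

Definition is_peak (n : nat) (pi : 'S_n) (i : nat) : bool :=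
  [&& 2 <= i, i <= n.-1,
      letter pi i.-1 < letter pi i & letter pi i.+1 < letter pi i].

Definition peak_set (n : nat) (pi : 'S_n) : {fset nat} :=
  [fset i in range1 n | is_peak pi i].

Definition perms_with_peaks (S : {fset nat}) (n : nat) : {set 'S_n} :=
  [set pi : 'S_n | peak_set pi == S].

Definition admissible (S : {fset nat}) (n : nat) : bool :=
  (S `<=` range1 n) && (perms_with_peaks S n != set0).

Definition perms_with_peaks_up (S : {fset nat}) (n k : nat) : {set 'S_n} :=
  [set pi in perms_with_peaks S n |
     (letter pi n.-1 < letter pi n) && (letter pi n == k)].

Definition max_or1 (S : {fset nat}) : nat :=
  if S == fset0 then 1 else \max_(i <- S) i.

(* Main.v *)
(** Let a = m - 1 and let S1 = S \ {m}.  Cut a permutation of [n] after its a-th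
letter, and require the first block to have peak set S1 and the last block to
have no peak and to end with an ascent to k.  Since a and a + 1 are not both
peaks, such a permutation has peak set S1, S1 + {a} or S1 + {m}, and every
permutation counted for one of these three sets arises.  Conversely, given the
set A of the first a letters, the first block can be chosen in |P(S1; a)| ways;
a word without peaks is built by inserting its letters in increasing order, each
at one of the two ends, so the last block can be chosen in 2^(j-1) ways, where
j > 0 is the number of letters below k outside A.  Summing over A gives
|P(S1; a)| times a sum of products C(k-1, i) C(n-k, a-i) 2^(k-2-i), a polynomial
in n of degree a because its i = 0 term is nonzero for k >= 2.  The counts for
S1 and S1 + {a} have degree less than a by induction, and |P(S1; a)| is nonzero
as S is admissible. *)
Require Import Defs.
From mathcomp Require Import all_boot all_order all_fingroup all_algebra.
From mathcomp Require Import finmap.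
From mathcomp Require Import zify ring.

Set Implicit Arguments.
Unset Strict Implicit.
Unset Printing Implicit Defensive.

Local Open Scope nat_scope.

(** * Peaks of words over the natural numbers *)

(** Words are used because, unlike elements of ['S_n], they can be cut and relabelled. Positions
    count from 1, so the i-th letter is [nth 0 w i.-1]. *)
Definition peak_at (w : seq nat) (i : nat) : bool :=
  [&& 2 <= i, i < size w, nth 0 w i.-2 < nth 0 w i.-1
    & nth 0 w i < nth 0 w i.-1].

Definition peaks (w : seq nat) : {fset nat} :=
  [fset i in range1 (size w) | peak_at w i]%fset.

Definition ends_up (k : nat) (w : seq nat) : bool :=
  (nth 0 w (size w).-2 < nth 0 w (size w).-1) && (nth 0 w (size w).-1 == k).

Lemma mem_peaks w i : (i \in peaks w) = peak_at w i.
Proof.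
rewrite !inE /= mem_iota; apply: andb_idl; rewrite /peak_at => /and4P[]; lia.
Qed.

Lemma peaksP w (S : {fset nat}) :
  reflect (forall i, peak_at w i = (i \in S)) (peaks w == S).
Proof.
apply: (iffP eqP) => [<- i|H]; first by rewrite mem_peaks.
by apply/fsetP => i; rewrite mem_peaks H.
Qed.

Lemma peaks0P w : reflect (forall i, ~~ peak_at w i) (peaks w == fset0).
Proof.
apply: (iffP (peaksP _ _)) => H i; first by rewrite H inE.
by rewrite inE (negbTE (H i)).
Qed.

Lemma size_one_line n (pi : 'S_n) : size (one_line pi) = n.
Proof. by rewrite size_map size_enum_ord. Qed.

Lemma peak_set_one_line n (pi : 'S_n) : peak_set pi = peaks (one_line pi).
Proof.
apply/fsetP => i; rewrite mem_peaks !inE /= mem_iota /is_peak /peak_at /letter.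
rewrite size_one_line.
case: (leqP 2 i) => /= hi; last by rewrite andbF.
have -> : (i <= n.-1) = (i < n) by lia.
by case: (ltnP i n) => hn /=; rewrite ?andbF // (ltnW hi); have -> : i < 1 + n by lia.
Qed.

Lemma ends_up_one_line n k (pi : 'S_n) :
  ends_up k (one_line pi) = (letter pi n.-1 < letter pi n) && (letter pi n == k).
Proof. by rewrite /ends_up /letter size_one_line. Qed.

(** * From permutations to words *)

Lemma uniq_leq_size_perm (T : eqType) (s1 s2 : seq T) :
  uniq s1 -> {subset s1 <= s2} -> size s2 <= size s1 -> perm_eq s1 s2.
Proof.
move=> u1 s12 le; have [_ e] := uniq_min_size u1 s12 le.
by apply: uniq_perm e => //; apply: leq_size_uniq s12 le.
Qed.

(** Both lists have [(size s)!] entries and the left one has no repetition, so one inclusion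
    suffices. *)
Lemma permutations_map (T U : eqType) (h : T -> U) (s : seq T) :
  uniq (map h s) ->
  perm_eq (permutations (map h s)) (map (map h) (permutations s)).
Proof.
case: s => [|x0 s0] //; move: (x0 :: s0) => s us.
apply: uniq_leq_size_perm; first exact: permutations_uniq.
  move=> t; rewrite mem_permutations => /(perm_iotaP (h x0))[Is].
  rewrite size_map => pIs ->; apply/mapP.
  exists (map (nth x0 s) Is).
    by rewrite mem_permutations; apply/(perm_iotaP x0); exists Is.
  rewrite -map_comp; apply/eq_in_map => i.
  by rewrite (perm_mem pIs) mem_iota => /= hi; rewrite (nth_map x0).
by rewrite !(size_map, size_permutations) ?(map_uniq us).
Qed.

Lemma count_permutations_map (T U : eqType) (h : T -> U) (P : pred (seq U))
    (s : seq T) :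
  uniq (map h s) ->
  count P (permutations (map h s)) = count (P \o map h) (permutations s).
Proof. by move=> us; rewrite (seq.permP (permutations_map us)) count_map. Qed.

Lemma one_line_inj n : injective (@one_line n).
Proof.
move=> p q; rewrite /one_line => /eq_in_map e; apply/permP => j; apply/val_inj/succn_inj/e.
by rewrite mem_enum.
Qed.

Lemma iota1_enum n : iota 1 n = [seq (val i).+1 | i <- enum 'I_n].
Proof. by rewrite (map_comp S val) val_enum_ord (iotaDl 1 0). Qed.

(** One-line notation is injective into the n! arrangements of [iota 1 n], hence reaches all of
    them. *)
Lemma card_one_line n (P : pred (seq nat)) :
  #|[set pi : 'S_n | P (one_line pi)]| = count P (permutations (iota 1 n)).
Proof.
have e : perm_eq (map (@one_line n) (enum 'S_n)) (permutations (iota 1 n)).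
  apply: uniq_leq_size_perm.
  - by rewrite (map_inj_uniq (@one_line_inj n)) enum_uniq.
  - move=> w /mapP[p _ ->]; rewrite mem_permutations.
    apply: uniq_perm; rewrite ?iota_uniq //.
      by rewrite map_inj_uniq ?enum_uniq // => i j [] /val_inj/perm_inj.
    rewrite iota1_enum => x; apply/mapP/mapP => -[j _ ->].
      by exists (p j); rewrite ?mem_enum.
    by exists (perm_inv p j); rewrite ?mem_enum // permKV.
  - by rewrite size_permutations ?iota_uniq // size_map -cardE card_Sn size_iota.
rewrite -(seq.permP e) count_map -sum1_card -sum1_count big_enum_cond.
by apply: eq_bigl => p; rewrite !inE.
Qed.

Definition card_peaks (S : {fset nat}) (n : nat) : nat :=
  count (fun w => peaks w == S) (permutations (iota 1 n)).

Definition card_peaks_up (S : {fset nat}) (n k : nat) : nat :=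
  count (fun w => (peaks w == S) && ends_up k w) (permutations (iota 1 n)).

Lemma card_perms_with_peaks S n : #|perms_with_peaks S n| = card_peaks S n.
Proof.
rewrite /card_peaks -(card_one_line n (fun w => peaks w == S)).
by apply: eq_card => p; rewrite !inE peak_set_one_line.
Qed.

Lemma card_perms_with_peaks_up S n k :
  #|perms_with_peaks_up S n k| = card_peaks_up S n k.
Proof.
rewrite /card_peaks_up -(card_one_line n (fun w => (peaks w == S) && ends_up k w)).
by apply: eq_card => p; rewrite !inE peak_set_one_line ends_up_one_line.
Qed.

(** * Cutting a permutation into two blocks *)

(** Permutations are grouped by the set A of their first a letters. Those with a given A are the
    words u ++ v with u an arrangement of A and v one of its complement, chosen independently. *)
Lemma count_permutations_split (T : finType) (f g : pred (seq T)) a :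
  a <= #|T| ->
  count (fun w => f (take a w) && g (drop a w)) (permutations (enum T)) =
  \sum_(A : {set T} | #|A| == a)
     count f (permutations (enum A)) * count g (permutations (enum (~: A))).
Proof.
move=> aT; set P := permutations (enum T).
have sP w : w \in P -> size w = #|T|.
  by rewrite mem_permutations => /perm_size ->; rewrite cardE.
have uP w : w \in P -> uniq w.
  by rewrite mem_permutations => /perm_uniq ->; rewrite enum_uniq.
rewrite -sum1_count big_seq_cond.
rewrite (partition_big (fun w => [set x in take a w])
          (fun A : {set T} => #|A| == a)) /=; last first.
  move=> w /andP[wP _]; apply/eqP.
  transitivity (size (take a w)); last by rewrite size_takel ?sP.
  by rewrite cardsE; apply/card_uniqP/take_uniq/uP.
apply: eq_bigr => A /eqP cA.
have cA' : size (enum A) = a by rewrite -cardE.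
pose Q := [seq u ++ v | u <- permutations (enum A), v <- permutations (enum (~: A))].
have mQ u v : perm_eq u (enum A) -> perm_eq v (enum (~: A)) ->
    (take a (u ++ v) = u) /\ (drop a (u ++ v) = v).
  by move=> /perm_size su _; rewrite take_size_cat ?drop_size_cat ?su ?cA'.
have e : perm_eq [seq w <- P | [set x in take a w] == A] Q.
  apply: uniq_perm.
  - by rewrite filter_uniq // permutations_uniq.
  - apply: allpairs_uniq; rewrite ?permutations_uniq // => -[u v] [u' v'].
    case/allpairsP => -[x y] /= [+ + [-> ->]]; rewrite !mem_permutations => px py.
    case/allpairsP => -[x' y'] /= [+ + [-> ->]]; rewrite !mem_permutations => px' py' /= E.
    have [d1 d2] := mQ _ _ px py; have [e1 e2] := mQ _ _ px' py'.
    by congr pair; [rewrite -d1 E e1 | rewrite -d2 E e2].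
  - move=> w; rewrite mem_filter; apply/andP/allpairsP => /=.
      case=> /eqP eA wP; exists (take a w, drop a w) => /=.
      have ut : uniq (take a w) by exact/take_uniq/uP.
      have := uP _ wP; rewrite -{1}(cat_take_drop a w) cat_uniq => /and3P[_ hd ud].
      rewrite !mem_permutations cat_take_drop; split => //.
        by apply: uniq_perm => // [|x]; rewrite ?enum_uniq // mem_enum -eA inE.
      apply: uniq_perm => // [|x]; rewrite ?enum_uniq // mem_enum inE -eA inE.
      have : x \in w.
        by move: wP; rewrite mem_permutations => /perm_mem ->; rewrite mem_enum.
      rewrite -{1}(cat_take_drop a w) mem_cat; case: (boolP (x \in take a w)) => //= xt _.
      by apply/negP => xd; case/negP: hd; apply/hasP; exists x.
    case=> -[u v] /= [+ + ->]; rewrite !mem_permutations => pu pv.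
    have [-> _] := mQ _ _ pu pv; split.
      by apply/eqP/setP => x; rewrite inE (perm_mem pu) mem_enum.
    apply: uniq_perm; rewrite ?enum_uniq //.
      rewrite cat_uniq (perm_uniq pu) (perm_uniq pv) !enum_uniq /= andbT.
      apply/negP => /hasP[x]; rewrite (perm_mem pu) (perm_mem pv) !mem_enum.
      by rewrite inE => /negP.
    by move=> x; rewrite mem_cat (perm_mem pu) (perm_mem pv) !mem_enum !inE orbN.
transitivity (count (fun w => f (take a w) && g (drop a w)) Q).
  rewrite -(seq.permP e) count_filter -sum1_count [RHS]big_seq_cond.
  by apply: eq_bigl => w; rewrite /= -!andbA.
rewrite count_flatten sumnE big_map big_map.
rewrite -[count f _]sum1_count big_distrl [in RHS]big_mkcond /=.
rewrite big_seq [RHS]big_seq; apply: eq_bigr => u.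
rewrite mem_permutations => pu; rewrite count_map.
rewrite (@eq_in_count _ _ (fun v => f u && g v)); last first.
  by move=> v; rewrite mem_permutations /= => pv; have [-> ->] := mQ _ _ pu pv.
by case: (f u); rewrite ?mul1n //= count_pred0.
Qed.

(** * Peaks under relabelling and cutting *)

Lemma peak_at_map (h : nat -> nat) (w : seq nat) i :
  {in w &, {mono h : x y / x < y}} -> peak_at (map h w) i = peak_at w i.
Proof.
move=> mono_h; rewrite /peak_at size_map.
case: (leqP 2 i) (ltnP i (size w)) => //= hi [] //= iw.
have i1 : i.-1 < size w by lia.
have i2 : i.-2 < size w by lia.
by rewrite !(nth_map 0) // !mono_h ?mem_nth.
Qed.

(** Peaks depend only on the relative order of the letters, and [h] is the increasing bijection from
    1, ..., [size s] to the letters of [s]. *)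
Lemma count_peaks_sorted (S : {fset nat}) (s : seq nat) :
  sorted ltn s ->
  count (fun w => peaks w == S) (permutations s) = card_peaks S (size s).
Proof.
move=> ss; have us : uniq s by exact: sorted_uniq ltn_trans ltnn _ ss.
pose h i := nth 0 s i.-1.
have es : s = map h (iota 1 (size s)).
  rewrite (iotaDl 1 0) -map_comp -[LHS](mkseq_nth 0).
  by apply: eq_map => i.
rewrite {1}es count_permutations_map -?es //.
apply: eq_in_count => w; rewrite mem_permutations => /perm_mem wE /=.
suff e i : peak_at (map h w) i = peak_at w i.
  by apply/peaksP/peaksP => H i; rewrite -H e.
apply: peak_at_map => x y; rewrite !wE !mem_iota => hx hy.
have homo := sorted_ltn_nth ltn_trans 0 ss.
rewrite /h; case: (ltngtP x y) => [lt|lt|->]; last by rewrite ltnn.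
  by apply: homo; rewrite ?inE; lia.
apply/negbTE; rewrite -leqNgt ltnW //.
by apply: homo; rewrite ?inE; lia.
Qed.

Lemma peak_at_take a w i :
  a <= size w -> peak_at (take a w) i = (i < a) && peak_at w i.
Proof.
move=> aw; rewrite /peak_at size_takel //.
case: (leqP 2 i); rewrite ?andbF //= => hi.
case: (ltnP i a) => //= ia; have -> /= : i < size w by lia.
by rewrite !nth_take //; lia.
Qed.

Lemma peak_at_drop a w i :
  peak_at (drop a w) i = (2 <= i) && peak_at w (a + i).
Proof.
rewrite /peak_at size_drop; case: (leqP 2 i) => //= hi.
have -> /= : 1 < a + i by lia.
have -> : (i < size w - a) = (a + i < size w) by lia.
by rewrite !nth_drop; do ![congr (_ && _)]; congr (nth _ _ _ < nth _ _ _); lia.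
Qed.

Lemma ends_up_drop k a w :
  a + 2 <= size w -> ends_up k (drop a w) = ends_up k w.
Proof.
move=> aw; rewrite /ends_up size_drop !nth_drop.
have -> : a + (size w - a).-1 = (size w).-1 by lia.
by have -> : a + (size w - a).-2 = (size w).-2 by lia.
Qed.

(** The first block tests the positions below a, the last block those from a + 2 on. Positions a and
    a + 1 are left free, but adjacent positions are not both peaks, which leaves three exclusive
    cases. *)
Lemma peaks_split (S : {fset nat}) a w :
  (forall i, i \in S -> i < a) -> a <= size w ->
  (peaks (take a w) == S) && (peaks (drop a w) == fset0) =
  (peaks w == S) + (peaks w == (a |` S)%fset) + (peaks w == (a.+1 |` S)%fset)
  :> nat.
Proof.
move=> Sa aw.
have aS : a \in S = false by apply/negP => /Sa; rewrite ltnn.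
have a1S : a.+1 \in S = false by apply/negP => /Sa; lia.
(* X stands for whichever of the three sets agrees with w at positions a and a + 1. *)
have key (X : {fset nat}) :
    (forall i, i < a -> (i \in X) = (i \in S)) ->
    (forall i, a.+1 < i -> i \notin X) ->
    (peak_at w a = (a \in X)) -> (peak_at w a.+1 = (a.+1 \in X)) ->
    (peaks (take a w) == S) && (peaks (drop a w) == fset0) = (peaks w == X).
  move=> X1 X2 ea ea1; apply/andP/peaksP => [[/peaksP p1 /peaks0P p2] i|H].
    case: (ltngtP i a) => [lt|gt|->//].
      by rewrite X1 // -p1 peak_at_take // lt.
    case: (ltngtP i a.+1) => [|gt1|->//]; first by clear -gt; lia.
    rewrite (negbTE (X2 _ gt1)); apply/negbTE.
    have hi : 1 < i - a by lia.
    by have := p2 (i - a); rewrite peak_at_drop hi (subnKC (ltnW gt)).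
  split; first apply/peaksP => i; last apply/peaks0P => i.
    rewrite peak_at_take // H; case: (ltnP i a) => [/X1 -> //|le].
    by apply/esym/negbTE/negP => /Sa; lia.
  rewrite peak_at_drop; case: (leqP 2 i) => //= hi; rewrite H; apply: X2; lia.
(* Each of the three equalities decides which of a and a + 1 are peaks, so at most one of them
   holds. *)
have e0 : (peaks w == S) ==> ~~ peak_at w a && ~~ peak_at w a.+1.
  by apply/implyP => /peaksP H; rewrite !H aS a1S.
have e1 : (peaks w == (a |` S)%fset) ==> peak_at w a && ~~ peak_at w a.+1.
  by apply/implyP => /peaksP H; rewrite !H !inE eqxx aS a1S; lia.
have e2 : (peaks w == (a.+1 |` S)%fset) ==> ~~ peak_at w a && peak_at w a.+1.
  by apply/implyP => /peaksP H; rewrite !H !inE eqxx aS a1S; lia.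
have e3 : ~~ (peak_at w a && peak_at w a.+1).
  clear; apply/negP => /andP[/and4P[? ? ? ?] /and4P[? ? /= ? ?]]; lia.
have outS i : a.+1 < i -> i \notin S by move=> hi; apply/negP => /Sa; lia.
case Ea: (peak_at w a) e0 e1 e2 e3; case Ea1 : (peak_at w a.+1) => //=.
- rewrite implybF implybT => /negbTE e0 _; rewrite implybF => /negbTE e2 _.
  rewrite e0 e2 addn0 (key (a |` S)%fset) ?inE ?eqxx ?Ea ?Ea1 ?aS ?a1S ?orbF //.
  + by move=> i hi; rewrite !inE ltn_eqF.
  + by move=> i hi; rewrite !inE negb_or outS // gtn_eqF // ltnW.
  + by rewrite gtn_eqF.
- rewrite !implybF implybT => /negbTE e0 /negbTE e1 _ _.
  rewrite e0 e1 (key (a.+1 |` S)%fset) ?inE ?eqxx ?Ea ?Ea1 ?aS ?a1S ?orbF //.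
  + by move=> i hi; rewrite !inE ltn_eqF // ltnS ltnW.
  + by move=> i hi; rewrite !inE negb_or outS // gtn_eqF.
  + by rewrite ltn_eqF.
- rewrite !implybF implybT => _ /negbTE e1 /negbTE e2 _.
  by rewrite e1 e2 !addn0 (key S) ?Ea ?Ea1 ?aS ?a1S.
Qed.

(** * Words without peaks *)

(** Position 2 of the new word follows a larger letter, so it is no peak; later positions are those
    of w shifted by one. *)
Lemma peaks_cons_max x w :
  (forall y, y \in w -> y < x) ->
  (peaks (x :: w) == fset0) = (peaks w == fset0).
Proof.
move=> xmax; apply/peaks0P/peaks0P => H i; apply/negP.
  move=> pi; have /and4P[i2 _ _ _] := pi; case/negP: (H i.+1).
  by move: pi; rewrite -{1}[w](drop0) -[drop 0 w]/(drop 1 (x :: w)) peak_at_drop => /andP[].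
case: i => [|[|[|i]]] // /and4P[_]; rewrite ?ltnS => hs /= lt1 lt2.
  by have := xmax _ (mem_nth 0 (ltnW hs)); rewrite ltnNge (ltnW lt1).
by case/negP: (H i.+2); apply/and4P.
Qed.

(** The former last letter is now followed by a larger one, and the new last position is never a
    peak. *)
Lemma peaks_rcons_max x w :
  (forall y, y \in w -> y < x) ->
  (peaks (rcons w x) == fset0) = (peaks w == fset0).
Proof.
move=> xmax; have tw : take (size w) (rcons w x) = w.
  by rewrite -cats1 take_size_cat.
have ptw i : peak_at w i = (i < size w) && peak_at (rcons w x) i.
  by rewrite -{1}tw peak_at_take // size_rcons.
apply/peaks0P/peaks0P => H i; first by rewrite ptw (negbTE (H i)) andbF.
have := H i; rewrite ptw; case: (ltnP i (size w)) => //= le _; apply/negP.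
case/and4P; rewrite size_rcons => i2 ltS _.
have ei : i = size w by apply/eqP; rewrite eqn_leq le -ltnS ltS.
rewrite ei !nth_rcons ltnn eqxx; have lw : (size w).-1 < size w by rewrite -ei; lia.
by rewrite lw; apply/negP; rewrite -leqNgt ltnW // xmax // mem_nth.
Qed.

Lemma ends_up_cons_max k x w :
  0 < size w -> (forall y, y \in w -> y < x) ->
  ends_up k (x :: w) = ends_up k w.
Proof.
(* For a one-letter w both sides are false: [x :: w] descends, and in w the truncated index
   [(size w).-2] compares the letter with itself. *)
case: w => [|y [|z w]] // _ xmax; rewrite /ends_up /= ltnn.
by rewrite ltnNge ltnW // xmax ?inE.
Qed.

Lemma ends_up_rcons_max k x w :
  0 < size w -> (forall y, y \in w -> y < x) ->
  ends_up k (rcons w x) = (x == k).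
Proof.
move=> w0 xmax; rewrite /ends_up size_rcons /= !nth_rcons ltnn eqxx.
have lw : (size w).-1 < size w by lia.
by rewrite lw xmax ?mem_nth.
Qed.

(* In a word without peaks the largest letter is the first or the last one. *)
Lemma count_peakless_max (Q : pred (seq nat)) x s :
  0 < size s -> uniq s -> (forall y, y \in s -> y < x) ->
  count (fun w => (peaks w == fset0) && Q w) (permutations (x :: s)) =
  count (fun w => (peaks w == fset0) && Q (x :: w)) (permutations s) +
  count (fun w => (peaks w == fset0) && Q (rcons w x)) (permutations s).
Proof.
move=> s0 us xmax.
have xs : x \notin s by apply/negP => /xmax; rewrite ltnn.
pose F := [seq w <- permutations s | peaks w == fset0].
have FP w : w \in F -> perm_eq w s.
  by rewrite mem_filter mem_permutations => /andP[].
have Fmax w y : perm_eq w s -> y \in w -> y < x by move=> /perm_mem ->; apply: xmax.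
have e : perm_eq [seq w <- permutations (x :: s) | peaks w == fset0]
                 (map (cons x) F ++ map (rcons^~ x) F).
  have uF : uniq F by rewrite filter_uniq ?permutations_uniq.
  apply: uniq_perm.
  - by rewrite filter_uniq ?permutations_uniq.
  - rewrite cat_uniq !map_inj_uniq ?uF ?andbT /=; first last.
    + by move=> u v [].
    + by move=> u v /rcons_inj[].
    (* A common word would begin with x and have a nonempty arrangement of s before its final x,
       putting x in s. *)
    apply/hasPn => _ /mapP[w /FP pw ->]; apply/negP => /mapP[v _].
    case: w pw => [/perm_size /= e0|y w /perm_mem pw [e _]].
      by rewrite -e0 in s0.
    by move: xs; rewrite -pw e mem_head.
  - move=> w; rewrite mem_filter mem_cat mem_permutations.
    apply/andP/orP => [[np pw]|].
      have xw : x \in w by rewrite (perm_mem pw) mem_head.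
      case/splitPr: xw np pw => u v np.
      rewrite -cat1s perm_catCA /= perm_cons => puv.
      case/lastP: u np puv => [|u y] np puv.
        move: puv => pv; left; apply: map_f; rewrite mem_filter mem_permutations pv.
        by rewrite -(peaks_cons_max (x := x)) ?np // => y; apply: Fmax.
      case: v np puv => [|z v] np puv.
        move: puv; rewrite cats0 => pu; right; rewrite cats1; apply: map_f.
        rewrite mem_filter mem_permutations pu -(peaks_rcons_max (x := x)).
          by rewrite -cats1 np.
        by move=> t; apply: Fmax.
      (* Between neighbours y and z the maximum x would be a peak, at position 2 once u is
         dropped. *)
      have tmax t : t \in rcons u y ++ z :: v -> t < x by apply: Fmax.
      suff : peak_at (drop (size u) (rcons u y ++ x :: z :: v)) 2.
        by rewrite peak_at_drop /= (negbTE (elimT (peaks0P _) np _)).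
      rewrite cat_rcons drop_size_cat // /peak_at /= !tmax //.
        by rewrite mem_cat mem_head orbT.
      by rewrite mem_cat mem_rcons mem_head.
    case=> /mapP[v vF ->]; have pv := FP _ vF; move: vF; rewrite mem_filter => /andP[np _].
      by rewrite peaks_cons_max ?perm_cons // => y; apply: Fmax.
    by rewrite peaks_rcons_max ?perm_rcons ?perm_cons // => y; apply: Fmax.
have -> : count (fun w => (peaks w == fset0) && Q w) (permutations (x :: s)) =
          count Q [seq w <- permutations (x :: s) | peaks w == fset0].
  by rewrite count_filter; apply: eq_count => w; rewrite /= andbC.
rewrite (seq.permP e) count_cat !count_map !count_filter.
by congr (_ + _); apply: eq_count => w; rewrite /= andbC.
Qed.

Lemma sorted_gtn_cons_max x (s : seq nat) :
  sorted gtn (x :: s) -> sorted gtn s /\ forall y, y \in s -> y < x.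
Proof.
move=> ss; split; first exact: path_sorted ss.
have gtn_trans : transitive gtn by move=> a b c /= ba /ltn_trans; apply.
by move=> y ys; have /allP/(_ y ys) := order_path_min gtn_trans ss.
Qed.

Lemma sorted_gtn_uniq (s : seq nat) : sorted gtn s -> uniq s.
Proof.
elim: s => //= x s IH ss; have [ss' xmax] := sorted_gtn_cons_max ss.
by rewrite IH // andbT; apply/negP => /xmax; rewrite ltnn.
Qed.

(** Each letter but the smallest goes to one of the two ends of the word formed by the smaller
    ones. *)
Lemma count_peakless (s : seq nat) :
  sorted gtn s -> 0 < size s ->
  count (fun w => peaks w == fset0) (permutations s) = 2 ^ (size s).-1.
Proof.
elim: s => // x [_ _ _|y s IH].
  rewrite /= addn0; apply/eqP; rewrite eqb1.
  by apply/peaks0P => i; rewrite /peak_at; case: i => [|[|]].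
move=> /(sorted_gtn_cons_max) []; move: IH; set t := y :: s => IH st xmax _.
rewrite -[(size _).-1]/(size s).+1.
have e := count_peakless_max predT (erefl : 0 < size t) (sorted_gtn_uniq st) xmax.
transitivity (count (fun w => (peaks w == fset0) && predT w) (permutations (x :: t))).
  by apply: eq_count => w /=; rewrite andbT.
have e2 : count (fun w => (peaks w == fset0) && true) (permutations t) = 2 ^ size s.
  by rewrite -[size s]/(size t).-1 -IH //; apply: eq_count => w; rewrite andbT.
by rewrite e /= e2 expnS mul2n addnn.
Qed.

(** Letters above k are forced to the left end and k to the right end; the j + 1 letters below k
    then form any of 2 ^ j words without peaks. With no letter below k, no ascent can end at k. *)
Lemma count_peakless_up k (s : seq nat) :
  uniq s -> k \in s ->
  count (fun w => (peaks w == fset0) && ends_up k w) (permutations s) =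
  if count (fun y => y < k) s is j.+1 then 2 ^ j else 0.
Proof.
move=> us.
(* In decreasing order the head is the largest letter, so induction on the list removes maxima. *)
have ps : perm_eq s (sort geq s) by rewrite perm_sym perm_sort.
rewrite (perm_mem ps) (seq.permP (perm_permutations ps)) (seq.permP ps).
have : sorted gtn (sort geq s).
  by rewrite gtn_sorted_uniq_geq sort_uniq us sort_sorted.
move: (sort geq s) => {ps us}{}s.
elim: s => // x [_ _|y s IH].
  rewrite inE => /eqP ->; rewrite /= ltnn.
  by rewrite /ends_up /= ltnn andbF.
move=> /sorted_gtn_cons_max []; move: IH; set t := y :: s => IH st xmax.
have ut := sorted_gtn_uniq st.
rewrite inE count_peakless_max // => /predU1P[->|kt].
  have -> : count (fun z => z < x) (x :: t) = (size s).+1.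
    have ct : count (fun z => z < x) t == size t by rewrite -all_count; apply/allP.
    by rewrite -cat1s count_cat (eqP ct) /= ltnn.
  rewrite [X in _ + X](@eq_in_count _ _ (fun w => peaks w == fset0)); last first.
    move=> w; rewrite mem_permutations => pw.
    rewrite ends_up_rcons_max ?eqxx ?andbT // ?(perm_size pw) // => z.
    by rewrite (perm_mem pw); apply: xmax.
  (* Placing x = k in front contributes nothing, since the last letter is then smaller than k. *)
  rewrite count_peakless // [X in X + _](@eq_in_count _ _ pred0) ?count_pred0 //.
  move=> w; rewrite mem_permutations /= => pw.
  have wmax z : z \in w -> z < x by rewrite (perm_mem pw); apply: xmax.
  rewrite ends_up_cons_max ?(perm_size pw) //; apply/negP => /andP[_ /andP[_ /eqP e]].
  have /wmax : nth 0 w (size w).-1 \in w by rewrite mem_nth // (perm_size pw) /=.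
  by rewrite e ltnn.
(* Here x exceeds k, so placing x last contributes nothing. *)
have kx := xmax _ kt.
rewrite -[x :: t]cat1s count_cat [count _ [:: x]]/= ltnNge (ltnW kx) add0n -IH //.
rewrite [X in _ + X](@eq_in_count _ _ pred0) ?count_pred0 ?addn0; last first.
  move=> w; rewrite mem_permutations /= => pw.
  rewrite ends_up_rcons_max ?(perm_size pw) // ?(gtn_eqF kx) ?andbF // => z.
  by rewrite (perm_mem pw); apply: xmax.
apply: eq_in_count => w; rewrite mem_permutations /= => pw.
rewrite ends_up_cons_max ?(perm_size pw) // => z.
by rewrite (perm_mem pw); apply: xmax.
Qed.

(** * Summing over the letters of the first block *)

(** Such sets A correspond to the pairs formed by an i-subset of L and a j-subset of R, through
    union and intersection. *)
Lemma card_draws2 (T : finType) (L R : {set T}) i j :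
  [disjoint L & R] ->
  #|[set A : {set T} | [&& A \subset L :|: R, #|A :&: L| == i & #|A :&: R| == j]]|
  = 'C(#|L|, i) * 'C(#|R|, j).
Proof.
move=> dLR; have LR0 : L :&: R = set0 by apply/eqP; rewrite setI_eq0.
have capL (A B : {set T}) : A \subset L -> B \subset R -> (A :|: B) :&: L = A.
  move=> AL BR; rewrite setIUl (setIidPl AL).
  suff -> : B :&: L = set0 by rewrite setU0.
  by apply/eqP; rewrite -subset0 -LR0 setIC setIS.
have capR (A B : {set T}) : A \subset L -> B \subset R -> (A :|: B) :&: R = B.
  move=> AL BR; rewrite setIUl (setIidPl BR).
  suff -> : A :&: R = set0 by rewrite set0U.
  by apply/eqP; rewrite -subset0 -LR0 setSI.
rewrite -!cards_draws -cardsX -(card_in_imset (f := fun p => p.1 :|: p.2)).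
  apply: eq_card => A; apply/idP/imsetP.
    rewrite inE => /and3P[sA cL cR]; exists (A :&: L, A :&: R).
      by rewrite !inE /= !subsetIr cL cR.
    by rewrite /= -setIUr; apply/esym/setIidPl.
  case=> -[B C]; rewrite !inE /= => /andP[/andP[BL cB] /andP[CR cC]] ->.
  by rewrite capL // capR // cB cC setUSS.
move=> [A B] [A' B']; rewrite !inE /=.
move=> /andP[/andP[AL _] /andP[BR _]] /andP[/andP[AL' _] /andP[BR' _]] e.
by rewrite -(capL A B) // e capL // -{1}(capR A B) // e capR.
Qed.

Lemma ends_up_mem k w : 0 < size w -> ends_up k w -> k \in w.
Proof. by move=> w0 /andP[_ /eqP <-]; rewrite mem_nth //; case: (w) w0 => //=. Qed.

Lemma count_sum (T : Type) (P : pred T) (s : seq T) :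
  count P s = \sum_(x <- s) (P x : nat).
Proof. by elim: s => [|x s IH]; rewrite ?big_nil ?big_cons //= IH. Qed.

(* Here i is the number of letters below k among the first a letters. *)
Definition last_block_count (n k a : nat) : nat :=
  \sum_(i < k.-1 | i <= a) 'C(k.-1, i) * 'C(n - k, a - i) * 2 ^ (k - 2 - i).

(** By [peaks_split] the left side counts the words whose two blocks satisfy independent conditions.
    The first block contributes the same factor for every A; the contribution of the last depends
    only on whether k is in A and on the number i of letters of A below k. *)
Lemma card_peaks_split S a n k :
  (forall i, i \in S -> i < a) -> a + 2 <= n -> 2 <= k <= n ->
  card_peaks_up S n k + card_peaks_up (a |` S)%fset n k
    + card_peaks_up (a.+1 |` S)%fset n k
  = card_peaks S a * last_block_count n k a.
Proof.
move=> Sa an /andP[k2 kn].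
pose h (i : 'I_n) := (val i).+1.
have h_inj : injective h by move=> x y [] /val_inj.
have umap (A : {pred 'I_n}) : uniq (map h (enum A)) by rewrite map_inj_uniq ?enum_uniq.
pose f u := peaks (map h u) == S.
pose g v := (peaks (map h v) == fset0) && ends_up k (map h v).
have -> : card_peaks_up S n k + card_peaks_up (a |` S)%fset n k
    + card_peaks_up (a.+1 |` S)%fset n k =
    count (fun w => f (take a w) && g (drop a w)) (permutations (enum 'I_n)).
  rewrite /card_peaks_up iota1_enum !(count_permutations_map (h := h)) ?umap //.
  rewrite !count_sum -!big_split /=.
  rewrite big_seq [RHS]big_seq; apply: eq_bigr => w.
  rewrite mem_permutations => /perm_size sw.
  have sh : size (map h w) = n by rewrite size_map sw -cardE card_ord.
  rewrite /f /g map_take map_drop ends_up_drop ?sh // andbA.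
  have := @peaks_split S a (map h w) Sa; rewrite sh => /(_ ltac:(lia)).
  by case: (ends_up k _); rewrite ?andbT ?andbF //; do 4!case: (_ == _).
rewrite count_permutations_split ?card_ord; last by lia.
have on : k.-1 < n by lia.
(* As ordinals start at 0, [o] stands for the letter k; L and R hold the letters below and above
   it. *)
pose o := Ordinal on.
pose L := [set x : 'I_n | x < k.-1]; pose R := [set x : 'I_n | k.-1 < x].
have cL : #|L| = k.-1.
  by rewrite -sum1dep_card -(big_ord_widen n (fun=> 1) (ltnW on)) sum1_card card_ord.
have LR0 : L :&: R = set0 by apply/setP => x; rewrite !inE; lia.
have dLR : [disjoint L & R] by rewrite -setI_eq0 LR0.
have LRo : L :|: R = [set~ o].
  apply/setP => x; rewrite !inE -val_eqE /=; lia.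
have cR : #|R| = n - k.
  by have := cardsC1 o; rewrite -LRo cardsU LR0 cards0 cL card_ord; lia.
have ho : h o = k by rewrite /h /=; lia.
(* The count is 0 if k is used up by the first block, or if all the letters below k are. *)
have gE (A : {set 'I_n}) : #|A| = a -> count g (permutations (enum (~: A))) =
    if (o \notin A) && (#|A :&: L| < k.-1) then 2 ^ (k - 2 - #|A :&: L|) else 0.
  move=> cA.
  have -> : count g (permutations (enum (~: A))) =
      count (fun w => (peaks w == fset0) && ends_up k w)
        (permutations (map h (enum (~: A)))) by rewrite count_permutations_map.
  have kmem : (k \in map h (enum (~: A))) = (o \notin A).
    by rewrite -ho mem_map // mem_enum inE.
  case: (boolP (o \notin A)) => /= oA; last first.
    rewrite (@eq_in_count _ _ pred0) ?count_pred0 // => w.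
    rewrite mem_permutations => pw; apply/negP => /andP[_ /ends_up_mem].
    rewrite (perm_mem pw) kmem (perm_size pw) size_map -cardE cardsCs setCK cA card_ord.
    have na : 0 < n - a by lia.
    by move=> /(_ na) oA'; rewrite oA' in oA.
  rewrite count_peakless_up ?kmem //.
  have -> : count (fun y => y < k) (map h (enum (~: A))) = k.-1 - #|A :&: L|.
    rewrite -cL -cardsDS ?subsetIr // setDIr setDv setU0 count_map.
    rewrite -sum1_count big_enum_cond /= sum1_card; apply: eq_card => x.
    rewrite unfold_in !inE; congr (_ && _); rewrite /h /=; lia.
  move: #|A :&: L| => c; case: ltnP => hc; last by rewrite (eqP hc).
  by have -> : k.-1 - c = (k - 2 - c).+1 by lia.
transitivity (\sum_(A : {set 'I_n} | [&& #|A| == a, o \notin A & #|A :&: L| < k.-1])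
    card_peaks S a * 2 ^ (k - 2 - #|A :&: L|)).
  rewrite [RHS]big_mkcond [LHS]big_mkcond /=; apply: eq_bigr => A _.
  case: eqP => //= cA; rewrite gE //.
  have -> : count f (permutations (enum A)) = card_peaks S a.
    have -> : count f (permutations (enum A)) =
       count (fun w => peaks w == S) (permutations (map h (enum A))).
      by rewrite count_permutations_map.
    rewrite count_peaks_sorted ?size_map -?cardE ?cA //.
    (* [enum A] is increasing, being a filter of the enumeration of ['I_n]. *)
    rewrite sorted_map /enum_mem; apply: sorted_filter.
      by move=> x y z; apply: ltn_trans.
    by rewrite -sorted_map -enumT -iota1_enum iota_ltn_sorted.
  by case: ifP; rewrite ?muln0.
rewrite -big_distrr /=; congr (_ * _).
have k0 : 0 < k.-1 by lia.
(* The value of [p A] is the size of [A :&: L]; under the summation condition the default of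
   [insubd] is not reached. *)
pose p (A : {set 'I_n}) := insubd (Ordinal k0) #|A :&: L|.
rewrite (partition_big p predT) //= /last_block_count [RHS]big_mkcond /=.
apply: eq_bigr => i _.
transitivity (\sum_(A in [set A : {set 'I_n} | [&& #|A| == a, o \notin A & #|A :&: L| == i]])
   2 ^ (k - 2 - i)).
  apply: eq_big => A.
    rewrite inE -!andbA; do 2![congr (_ && _)]; rewrite /p.
    case: ltnP => [lt|ge] /=; last by apply/esym/negbTE; have := ltn_ord i; lia.
    by rewrite -val_eqE /= val_insubd lt.
  rewrite /p => /andP[/and3P[_ _ lt]].
  by rewrite -val_eqE /= val_insubd lt => /eqP ->.
rewrite sum_nat_const.
have csum (A : {set 'I_n}) : A \subset L :|: R -> #|A| = #|A :&: L| + #|A :&: R|.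
  move=> /setIidPl {1}<-; rewrite setIUr cardsU setIACA setIid.
  by rewrite LR0 setI0 cards0 subn0.
(* For i > a no set of size a meets L in i elements. *)
case: leqP => ia; last first.
  rewrite (_ : [set _ | _] = set0) ?cards0 //; apply/setP => A; rewrite !inE.
  apply/negP => /and3P[/eqP cA _ /eqP cAL].
  by have := subset_leq_card (subsetIl A L); lia.
rewrite -cR -[X in 'C(X, i)]cL -card_draws2 //; congr (_ * _).
apply: eq_card => A; rewrite !inE LRo subsetC sub1set inE.
case: (boolP (o \in A)) => oA; rewrite ?andbF //=.
have e := csum A; rewrite LRo subsetC sub1set inE oA in e; rewrite (e isT) {e}.
move: #|A :&: L| #|A :&: R| => c d.
apply/andP/andP => -[/eqP ? /eqP ?]; split; apply/eqP; lia.
Qed.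

(** * Binomial coefficients as polynomials *)

Section BinomialPolynomial.
Import GRing.Theory Num.Theory.
Local Open Scope ring_scope.

(** The binomial coefficient C(X, j). *)
Definition bin_poly (j : nat) : {poly rat} :=
  (j`!%:R)^-1 *: \prod_(0 <= t < j) ('X - t%:R%:P).

Lemma size_bin_poly j : size (bin_poly j) = j.+1.
Proof.
rewrite size_scale ?invr_eq0 ?pnatr_eq0 -?lt0n ?fact_gt0 //.
by rewrite size_prod_XsubC size_iota subn0.
Qed.

Lemma horner_bin_poly j x :
  (bin_poly j).[x] = (j`!%:R)^-1 * \prod_(0 <= t < j) (x - t%:R).
Proof.
by rewrite hornerZ horner_prod; congr (_ * _); apply: eq_bigr => t _; rewrite hornerXsubC.
Qed.

(** After removing the common factor x (x - 1) ... (x - j + 1), this is x + 1 = (x - j) + (j +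
    1). *)
Lemma bin_poly_pascal j x :
  (bin_poly j.+1).[x + 1] = (bin_poly j.+1).[x] + (bin_poly j).[x].
Proof.
rewrite !horner_bin_poly factS natrM.
have jn0 : j.+1%:R != 0 :> rat by rewrite pnatr_eq0.
have fn0 : j`!%:R != 0 :> rat by rewrite pnatr_eq0 -lt0n fact_gt0.
rewrite big_nat_recl // [in RHS]big_nat_recr //= subr0.
rewrite (eq_bigr (fun t => x - t%:R)) => [|t _]; last by rewrite -natr1; ring.
set P := \prod_(_ <= _ < _) _.
rewrite -natr1 in jn0 *; field.
by rewrite fn0.
Qed.

Lemma bin_poly0 j : (bin_poly j).[0] = (j == 0%N)%:R.
Proof.
rewrite horner_bin_poly; case: j => [|j]; first by rewrite big_geq // invr1 mulr1.
by rewrite big_nat_recl // subrr mul0r mulr0.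
Qed.

Lemma bin_polyE (n j : nat) : (bin_poly j).[n%:R] = 'C(n, j)%:R.
Proof.
elim: n j => [|n IH] [|j]; rewrite ?bin_poly0 //.
  by rewrite horner_bin_poly big_geq // bin0 invr1 mulr1.
by rewrite -natr1 bin_poly_pascal !IH binS natrD.
Qed.

(** For each j, Pascal's rule carries integrality from 0 upwards and, read backwards, down to the
    negative integers. *)
Lemma bin_poly_int j (z : int) : (bin_poly j).[z%:~R] \is a Num.int.
Proof.
elim: j z => [|j IH] z.
  by rewrite horner_bin_poly big_geq // invr1 mulr1.
elim/int_ind: z => [|n IHn|n IHn].
- by rewrite bin_poly0.
- by rewrite -pmulrn -natr1 bin_poly_pascal rpredD ?(IH n) ?IHn.
- set x := (- n.+1%:Z)%:~R.
  have xS : x + 1 = (- n%:Z)%:~R by rewrite /x !rmorphN /= -!pmulrn -natr1; ring.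
  have -> : (bin_poly j.+1).[x] = (bin_poly j.+1).[x + 1] - (bin_poly j).[x].
    by rewrite bin_poly_pascal addrK.
  by rewrite xS rpredB // IH.
Qed.

Definition last_block_poly (k a : nat) : {poly rat} :=
  \sum_(i < k.-1 | (i <= a)%N)
     ('C(k.-1, i) * 2 ^ (k - 2 - i))%:R *: (bin_poly (a - i) \Po ('X - k%:R%:P)).

Lemma last_block_polyE n k a :
  (k <= n)%N -> (last_block_poly k a).[n%:R] = (last_block_count n k a)%:R.
Proof.
move=> kn; rewrite /last_block_poly horner_sum natr_sum; apply: eq_bigr => i _.
rewrite hornerZ horner_comp hornerXsubC -natrB // bin_polyE -natrM.
by rewrite mulnAC.
Qed.

Lemma last_block_poly_int k a (z : int) :
  (last_block_poly k a).[z%:~R] \is a Num.int.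
Proof.
rewrite horner_sum rpred_sum // => i _.
rewrite hornerZ horner_comp hornerXsubC rpredM ?natr_int //.
by rewrite -[k%:R]/(k%:Z%:~R) -rmorphB bin_poly_int.
Qed.

(** The term i = 0 has degree a and nonzero factor 2 ^ (k - 2); the other terms have degree at most
    a - i. *)
Lemma size_last_block_poly k a : (2 <= k)%N -> size (last_block_poly k a) = a.+1.
Proof.
case: k => [|[|k]] // _; rewrite /last_block_poly /= big_mkcond big_ord_recl /=.
have szB i : size (bin_poly i \Po ('X - k.+2%:R%:P)) = i.+1.
  by rewrite size_comp_poly2 ?size_bin_poly // size_XsubC.
have sz0 : size (('C(k.+1, 0) * 2 ^ (k.+2 - 2 - 0))%:R *:
    (bin_poly (a - 0) \Po ('X - k.+2%:R%:P))) = a.+1.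
  by rewrite size_scale ?szB ?subn0 // bin0 mul1n pnatr_eq0 expn_eq0.
rewrite size_polyDl sz0 // ltnS; apply: leq_trans (size_sum _ _ _) _.
apply/bigmax_leqP => i _; case: ifP => [ia|_]; last by rewrite size_poly0.
apply: leq_trans (size_scale_leq _ _) _; rewrite szB /bump /= in ia *.
by rewrite -subSn // subSS leq_subr.
Qed.

End BinomialPolynomial.

(** * Impossible peak sets and the empty peak set *)

Lemma peak_at_adjacent w i : peak_at w i -> ~~ peak_at w i.+1.
Proof. by case/and4P => _ _ _ lt; apply/negP => /and4P[_ _ /= lt' _]; lia. Qed.

Lemma card_peaks_up_eq0 (S : {fset nat}) n k i :
  i \in S -> (i < 2) || (i.+1 \in S) -> card_peaks_up S n k = 0.
Proof.
move=> iS i1S; rewrite /card_peaks_up (@eq_count _ _ pred0) ?count_pred0 // => w.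
apply/negP => /andP[/peaksP pw _].
have pi : peak_at w i by rewrite pw.
case/orP: i1S => [|i1S]; first by case/and4P: pi; lia.
by have := peak_at_adjacent pi; rewrite pw i1S.
Qed.

Lemma card_peaks_up0 n k :
  2 <= k <= n -> card_peaks_up fset0 n k = 2 ^ (k - 2).
Proof.
move=> /andP[k2 kn].
rewrite /card_peaks_up count_peakless_up ?iota_uniq //; last first.
  by rewrite mem_iota (ltnW k2).
suff -> : count (fun y => y < k) (iota 1 n) = (k - 2).+1 by [].
(* This cuts [iota 1 n] into the k - 1 letters below k and the letters from k on. *)
have -> : n = (k - 2).+1 + (n - k).+1 by lia.
rewrite iotaD count_cat; have -> : 1 + (k - 2).+1 = k by lia.
rewrite [X in _ + X](@eq_in_count _ _ pred0) ?count_pred0 ?addn0 => [|i]; last first.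
  by rewrite mem_iota => /andP[ki _] /=; rewrite ltnNge ki.
apply/eqP; rewrite -[X in _ == X](size_iota 1) -all_count; apply/allP => i.
by rewrite mem_iota => /andP[_]; have -> : 1 + (k - 2).+1 = k by lia.
Qed.

(** * The polynomial, by induction on a bound for S *)

Section PeakPolynomial.
Import GRing.Theory Num.Theory.
Local Open Scope ring_scope.

(** The degree is only bounded, because the induction also meets sets that are no peak set, with
    polynomial 0, and because m may exceed the maximum of S. *)
Definition peak_polynomial (S : {fset nat}) (m k : nat) (p : {poly rat}) : Prop :=
  [/\ (size p <= m)%N,
      forall z : int, p.[z%:~R] \is a Num.int
    & forall n : nat, (k <= n)%N -> (m < n)%N ->
        (card_peaks_up S n k)%:R = p.[n%:R]].

(** This solves [card_peaks_split] for its third count. Both subtracted polynomials have size at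
    most a, so they cannot cancel the leading term of degree a. *)
Lemma peak_polynomial_step S a k p0 p1 :
  (2 <= k)%N -> (forall i, i \in S -> (i < a)%N) ->
  peak_polynomial S a k p0 -> peak_polynomial (a |` S)%fset a k p1 ->
  let p := (card_peaks S a)%:R *: last_block_poly k a - (p0 + p1) in
  peak_polynomial (a.+1 |` S)%fset a.+1 k p /\
  (card_peaks S a != 0%N -> size p = a.+1).
Proof.
move=> k2 Sa [sz0 int0 e0] [sz1 int1 e1] p.
have sz01 : (size (- (p0 + p1)) <= a)%N.
  by rewrite size_polyN (leq_trans (size_polyD _ _)) // geq_max sz0.
split; last first.
  move=> c0; rewrite /p size_polyDl size_scale ?size_last_block_poly //.
  - by rewrite pnatr_eq0.
  - by rewrite pnatr_eq0.
split.
- rewrite (leq_trans (size_polyD _ _)) // geq_max (leq_trans sz01) // andbT.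
  by rewrite (leq_trans (size_scale_leq _ _)) ?size_last_block_poly.
- move=> z; rewrite !hornerE rpredB ?rpredD ?rpredM ?natr_int //.
  exact: last_block_poly_int.
- move=> n kn an; rewrite !hornerE last_block_polyE // -natrM -card_peaks_split ?k2 //; last lia.
  rewrite -e0 ?(ltnW an) // -e1 ?(ltnW an) // !natrD; ring.
Qed.

Lemma peak_polynomial0 k m :
  (2 <= k)%N -> (0 < m)%N -> peak_polynomial fset0 m k (2 ^ (k - 2))%:R%:P.
Proof.
move=> k2 m0; split=> [|z|n kn _]; rewrite ?hornerC ?natr_int //.
  by rewrite (leq_trans (size_polyC_leq1 _)).
by rewrite card_peaks_up0 ?k2.
Qed.

Lemma exists_peak_polynomial (S : {fset nat}) m k :
  (2 <= k)%N -> (0 < m)%N -> (forall i, i \in S -> (i <= m)%N) ->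
  exists p, peak_polynomial S m k p.
Proof.
move=> k2; elim: m S => // m IH S _ Sm.
have zero i : i \in S -> (i < 2)%N || (i.+1 \in S) ->
    exists p, peak_polynomial S m.+1 k p.
  move=> iS h; exists 0; split=> [|z|n _ _]; rewrite ?size_poly0 ?horner0 ?rpred0 //.
  by rewrite (card_peaks_up_eq0 _ _ iS).
have [->|[i iS]] := fset_0Vmem S.
  by exists (2 ^ (k - 2))%:R%:P; apply: peak_polynomial0.
(* For m = 0 the elements of S are at most 1, where no peak can be. *)
case: (posnP m) => [m0|m0].
  by apply: (zero i) => //; have := Sm i iS; rewrite m0; lia.
case: (boolP (m.+1 \in S)) => [mS|mS]; last first.
  have [|p [sz ip ep]] := IH S m0.
    by move=> j jS; have := Sm j jS; rewrite leq_eqVlt => /predU1P[e|//]; rewrite -e jS in mS.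
  by exists p; split => // [|n kn mn]; [apply: leqW | apply: ep => //; apply: ltnW].
case: (boolP (m \in S)) => [mS'|mS']; first by apply: (zero m); rewrite ?mS ?orbT.
(* Now m is not in S, so S1 lies below m, and both S1 and S1 with m added fall under the induction
   hypothesis. *)
pose S1 := (S `\ m.+1)%fset.
have S1m j : j \in S1 -> (j < m)%N.
  rewrite !inE => /andP[jm jS]; have := Sm j jS; rewrite leq_eqVlt (negbTE jm) /= ltnS.
  by rewrite leq_eqVlt => /predU1P[e|//]; rewrite -e jS in mS'.
have [|p0 h0] := IH S1 m0; first by move=> j /S1m/ltnW.
have [|p1 h1] := IH (m |` S1)%fset m0; first by move=> j /fset1UP[->|/S1m/ltnW].
have [h _] := peak_polynomial_step k2 S1m h0 h1.
by rewrite fsetD1K // in h; eexists; exact: h.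
Qed.

End PeakPolynomial.

(** * Nonvanishing of the leading coefficient, and the conclusion *)

Lemma mem_bigmax (r : seq nat) : r != [::] -> \max_(i <- r) i \in r.
Proof.
elim: r => // x [_ _|y r IH _]; first by rewrite big_seq1 mem_head.
rewrite big_cons inE; case: leqP => _; last by rewrite eqxx.
by rewrite IH ?orbT.
Qed.

(** The first a letters of w have peak set S by [peaks_split], and standardizing them gives a
    permutation of [a]. *)
Lemma card_peaks_neq0 (S : {fset nat}) a w :
  (forall i, i \in S -> i < a) -> uniq w -> a < size w ->
  peaks w = (a.+1 |` S)%fset -> card_peaks S a != 0.
Proof.
move=> Sa uw aw pw.
have := peaks_split Sa (ltnW aw); rewrite pw eqxx.
case: (boolP (peaks (take a w) == S)) => [pt _|_]; last by rewrite /= addn1.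
have su : sorted ltn (sort leq (take a w)).
  by rewrite ltn_sorted_uniq_leq sort_uniq take_uniq // sort_sorted.
have := count_peaks_sorted S su; rewrite size_sort size_takel ?(ltnW aw) // => <-.
rewrite -lt0n -has_count; apply/hasP; exists (take a w) => //.
by rewrite mem_permutations perm_sym perm_sort.
Qed.

Theorem theorem12 (S : {fset nat})
    (S_pos : forall i : nat, i \in S -> (0 < i)%N)
    (S_adm : exists n : nat, admissible S n)
    (k : nat) (k_ge2 : (2 <= k)%N) :
  exists p : {poly rat},
    [/\ (* p is nonzero of degree m - 1 *)
        size p = (max_or1 S).-1.+1,
        forall z : int, (p.[z%:~R] \is a Num.int)%R
      & forall n : nat, (k <= n)%N -> (S `<=` range1 n.-1)%fset ->
          admissible S n ->
          (#|perms_with_peaks_up S n k|%:R = p.[n%:R])%R].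
Proof.
rewrite /max_or1; case: eqP => [->|/eqP S0].
  have [_ ip ep] := peak_polynomial0 k_ge2 (leqnn 1).
  exists (2 ^ (k - 2))%:R%:P%R; split=> // [|n kn _ _].
    by rewrite size_polyC Num.Theory.pnatr_eq0 expn_eq0.
  by rewrite card_perms_with_peaks_up ep // (leq_trans k_ge2).
set m := \max_(i <- S) i.
have mS : m \in S.
  apply: (@mem_bigmax S); apply: contra S0 => /eqP e.
  by apply/eqP/fsetP => i; rewrite -[i \in S]/(i \in (S : seq nat)) e.
have Sm i : i \in S -> i <= m by move=> iS; apply: leq_bigmax_seq.
have [n0 /andP[_ /set0Pn[pi]]] := S_adm.
rewrite inE peak_set_one_line => /eqP; set w := one_line pi => pw.
have uw : uniq w.
  by rewrite map_inj_uniq ?enum_uniq // => i j [] /val_inj/perm_inj.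
(* Admissibility supplies a word with a peak at m, so m is at least 2; below, m = a + 2 and the cut
   is after letter a + 1. *)
have /and4P[m2 mw _ _] : peak_at w m by rewrite -mem_peaks pw.
case em : m m2 mw => [|[|a]] // _ mw.
have aS : a.+1 \notin S.
  by apply/negP; rewrite -pw mem_peaks => /peak_at_adjacent; rewrite -mem_peaks pw -em mS.
pose S1 := (S `\ a.+2)%fset.
have SE : (a.+2 |` S1)%fset = S by rewrite fsetD1K // -em.
have S1a i : i \in S1 -> i < a.+1.
  rewrite !inE => /andP[ia iS]; have := Sm i iS.
  by rewrite em leq_eqVlt (negbTE ia) /= ltnS leq_eqVlt => /predU1P[e|//]; rewrite -e iS in aS.
have [||p0 h0] := @exists_peak_polynomial S1 a.+1 k k_ge2; first by [].
  by move=> i /S1a/ltnW.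
have [||p1 h1] := @exists_peak_polynomial (a.+1 |` S1)%fset a.+1 k k_ge2; first by [].
  by move=> i /fset1UP[->|/S1a/ltnW].
have [] := peak_polynomial_step k_ge2 S1a h0 h1.
set p := (_ *: _ - _)%R; rewrite SE => -[_ ip ep] szp.
exists p; split=> // [|n kn Sn _].
  rewrite szp //; apply: (card_peaks_neq0 S1a uw); first exact: ltnW mw.
  by rewrite SE.
rewrite card_perms_with_peaks_up ep //.
(* From m in [n - 1] follows m < n, the range in which the polynomial is valid. *)
have := fsubsetP Sn _ mS; rewrite em !inE /= mem_iota; lia.
Qed.
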